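(* Let $V$ be an indecomposable object of $\mathcal I^{fin}$. Then its pseudo-Jordan-Hölder series is unique up to equivalence, i.e. any two pseudo-Jordan-Hölder series of $V$ are equivalent.
   Context: $\mathfrak g$ is a complex finite-dimensional simple Lie algebra with Cartan subalgebra $\mathfrak h$, positive roots $R^+$, weight lattice $P$, dominant weights $P^+$; $x_\alpha^\pm$ ($\alpha\in R^+$) is a nonzero element of $\mathfrak g_{\pm\alpha}$; $\mathfrak n^+=\bigoplus_{\alpha\in R^+}\mathfrak g_\alpha$. $L(\mathfrak a)=\mathfrak a\otimes\mathbb C[t,t^{-1}]$, $L^e(\mathfrak a)=L(\mathfrak a)\oplus\mathbb Cd$ with $[d,x\otimes t^n]=n\,x\otimes t^n$; $\mathfrak h_e=\mathfrak h\oplus\mathbb Cd$; $\delta\in\mathfrak h_e^*$, $\delta(d)=1$, $\delta(\mathfrak h)=0$; $\mathfrak h^*\subset\mathfrak h_e^*$ via $\lambda(d)=0$; $P_e=P\oplus\mathbb Z\delta$, $P_e^+=P^+\oplus\mathbb Z\delta$. An $L^e(\mathfrak g)$-module $V$ is integrable if it is the direct sum of its $\mathfrak h_e$-weight spaces $V_\mu$ and all $x_\alpha^\pm\otimes t^s$ ($\alpha\in R^+,s\in\mathbb Z$) act locally nilpotently; $\mathrm{wt}^e(V)=\{\mu:V_\mu\neq0\}$. $\mathcal I^{fin}$: integrable $L^e(\mathfrak g)$-modules with $\mathrm{wt}^e(V)\subset P_e$ and finite-dimensional weight spaces. $\mathbb C_{r\delta}$ is the one-dimensional module on which $L(\mathfrak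 g)$ acts by $0$ and $d$ by $r$. For $\lambda\in P_e^+\setminus\mathbb Z\delta$, $V_\lambda^+=\{v\in V_\lambda:L(\mathfrak n^+)v=0\}$. A nonzero $v\in V_\lambda^+$ is an $\ell$-highest weight vector if $\mathbf U(L^e(\mathfrak h))v$ is an indecomposable $\mathbf U(L^e(\mathfrak h))$-module and $\dim(\mathbf U(L^e(\mathfrak h))v)_{\lambda+r\delta}\le1$ for all $r\in\mathbb Z$; $V$ is $\ell$-highest weight if $V=\mathbf U(L^e(\mathfrak g))v$ for some $\ell$-highest weight vector $v$. A pseudo-Jordan-Hölder series of $V\in\mathcal I^{fin}$ is a finite chain of $L^e(\mathfrak g)$-submodules $V=V_N\supsetneq V_{N-1}\supsetneq\cdots\supsetneq V_1\supsetneq V_0=0$ such that for each $k$ either (i) $V_k/V_{k-1}$ is a simple $\ell$-highest weight module with $\mathrm{wt}^e(V_k/V_{k-1})\not\subset\mathbb Z\delta$, or (ii) $V_k/V_{k-1}\cong\bigoplus_{r\in\mathbb Z}\mathbb C_{r\delta}^{m_r}$ for some $m_r\in\mathbb Z_{\ge0}$; and, for all $k$, at most one of $V_k/V_{k-1}$, $V_{k+1}/V_k$ satisfies (ii). Two finite chains of submodules $V=V_N\supseteq\cdots\supseteq V_0=0$ and $V=V'_{N'}\supseteq\cdots\supseteq V'_0=0$ are equivalent if (a) $|\{0<i\le N:\mathrm{wt}^e(V_i/V_{i-1})\not\subset\mathbb Z\delta\}|=|\{0<j\le N':\mathrm{wt}^e(V'_j/V'_{j-1})\not\subset\mathbb Z\delta\}|$,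 and (b) for each $0<i\le N$ with $\mathrm{wt}^e(V_i/V_{i-1})\not\subset\mathbb Z\delta$ there is $0<j\le N'$ with $V_i/V_{i-1}\cong V'_j/V'_{j-1}$. *)

(* Defs.v *)
From HB Require Import structures.
From mathcomp Require Import ssrAC.
From mathcomp Require Import all_boot all_order all_algebra generic_quotient ring_quotient finmap.
From mathcomp Require Import boolp classical_sets reals.
From mathcomp Require Import complex.

Set Implicit Arguments.
Unset Strict Implicit.
Unset Printing Implicit Defensive.

Import GRing.Theory.

Local Open Scope ring_scope.
Local Open Scope classical_set_scope.

HB.mixin Record Lmodule_isLieAlgebra (K : fieldType) L of GRing.Lmodule K L := {
  lie : L -> L -> L;
  lie_linearl : forall y, linear (lie^~ y);
  lie_linearr : forall x, linear (lie x);
  liexx : forall x, lie x x = 0;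
  lie_jacobi : forall x y z,
    lie x (lie y z) + lie y (lie z x) + lie z (lie x y) = 0
}.

#[short(type="lieAlgType")]
HB.structure Definition LieAlgebra (K : fieldType) :=
  {L of GRing.Lmodule K L & Lmodule_isLieAlgebra K L}.

#[short(type="finLieAlgType")]
HB.structure Definition FinLieAlgebra (K : fieldType) :=
  {L of Vector K L & Lmodule_isLieAlgebra K L}.

Section LieTheory.
Context {K : fieldType} {L : lieAlgType K}.
Implicit Types x y z : L.

Lemma lieDl x y z : lie (x + y) z = lie x z + lie y z.
Proof. by have := lie_linearl z 1 x y; rewrite !scale1r. Qed.
Lemma lie0l z : lie 0 z = 0.
Proof. by apply: (addrI (lie 0 z)); rewrite -lieDl !addr0. Qed.
Lemma lieZl a x z : lie (a *: x) z = a *: lie x z.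
Proof. by have := lie_linearl z a x 0; rewrite !addr0 lie0l addr0. Qed.
Lemma lieDr x y z : lie z (x + y) = lie z x + lie z y.
Proof. by have := lie_linearr z 1 x y; rewrite !scale1r. Qed.
Lemma lie0r z : lie z 0 = 0.
Proof. by apply: (addrI (lie z 0)); rewrite -lieDr !addr0. Qed.
Lemma lieZr a x z : lie z (a *: x) = a *: lie z x.
Proof. by have := lie_linearr z a x 0; rewrite !addr0 lie0r addr0. Qed.
Lemma lieC x y : lie x y = - lie y x.
Proof.
apply/eqP; rewrite -addr_eq0; apply/eqP.
by have := liexx (x + y); rewrite lieDl !lieDr !liexx add0r addr0.
Qed.

End LieTheory.

Definition fsmod (K : fieldType) (I : choiceType) (M : lmodType K) :=
  {fsfun I -> M with 0}.

Section FsMod.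
Context {K : fieldType} {I : choiceType} {M : lmodType K}.
Implicit Types f g h : fsmod I M.

HB.instance Definition _ := Choice.on (fsmod I M).

Definition fsm_add f g : fsmod I M :=
  [fsfun i in (finsupp f `|` finsupp g)%fset => f i + g i | 0].
Definition fsm_opp f : fsmod I M := [fsfun i in finsupp f => - f i | 0].
Definition fsm_scale a f : fsmod I M := [fsfun i in finsupp f => a *: f i | 0].
Definition fsm0 : fsmod I M := [fsfun].

Lemma fsm_addE f g i : fsm_add f g i = f i + g i.
Proof.
rewrite fsfunE in_fsetU; case: ifPn => //.
by case/norP=> /fsfun_dflt-> /fsfun_dflt->; rewrite addr0.
Qed.
Lemma fsm_oppE f i : fsm_opp f i = - f i.
Proof. by rewrite fsfunE; case: finsuppP; rewrite ?oppr0. Qed.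
Lemma fsm_scaleE a f i : fsm_scale a f i = a *: f i.
Proof. by rewrite fsfunE; case: finsuppP; rewrite ?scaler0. Qed.
Lemma fsm0E i : fsm0 i = 0. Proof. by rewrite fsfunE. Qed.

Fact fsm_addA : associative fsm_add.
Proof. by move=> f g h; apply/fsfunP => i; rewrite !fsm_addE addrA. Qed.
Fact fsm_addC : commutative fsm_add.
Proof. by move=> f g; apply/fsfunP => i; rewrite !fsm_addE addrC. Qed.
Fact fsm_add0 : left_id fsm0 fsm_add.
Proof. by move=> f; apply/fsfunP => i; rewrite !fsm_addE fsm0E add0r. Qed.
Fact fsm_addN : left_inverse fsm0 fsm_opp fsm_add.
Proof. by move=> f; apply/fsfunP => i; rewrite fsm_addE fsm_oppE fsm0E addNr. Qed.

HB.instance Definition _ := GRing.isZmodule.Build (fsmod I M)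
  fsm_addA fsm_addC fsm_add0 fsm_addN.

Fact fsm_scaleA a b f : fsm_scale a (fsm_scale b f) = fsm_scale (a * b) f.
Proof. by apply/fsfunP => i; rewrite !fsm_scaleE scalerA. Qed.
Fact fsm_scale1 : left_id 1 fsm_scale.
Proof. by move=> f; apply/fsfunP => i; rewrite fsm_scaleE scale1r. Qed.
Fact fsm_scaleDr : right_distributive fsm_scale +%R.
Proof.
by move=> a f g; apply/fsfunP => i; rewrite !(fsm_addE, fsm_scaleE) scalerDr.
Qed.
Fact fsm_scaleDl f : {morph fsm_scale^~ f : a b / a + b}.
Proof.
by move=> a b; apply/fsfunP => i; rewrite !(fsm_addE, fsm_scaleE) scalerDl.
Qed.

HB.instance Definition _ := GRing.Zmodule_isLmodule.Build K (fsmod I M)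
  fsm_scaleA fsm_scale1 fsm_scaleDr fsm_scaleDl.

Lemma fsmD f g i : (f + g) i = f i + g i. Proof. exact: fsm_addE. Qed.
Lemma fsmN f i : (- f) i = - f i. Proof. exact: fsm_oppE. Qed.
Lemma fsmZ a f i : (a *: f) i = a *: f i. Proof. exact: fsm_scaleE. Qed.
Lemma fsm0i i : (0 : fsmod I M) i = 0. Proof. exact: fsm0E. Qed.

Lemma fsm_sum J (r : seq J) (F : J -> fsmod I M) i :
  (\sum_(j <- r) F j) i = \sum_(j <- r) F j i.
Proof. by elim/big_rec2: _ => [|j y x _ <-]; rewrite ?fsm0i ?fsmD. Qed.

Definition single (i : I) (x : M) : fsmod I M := [fsfun fsm0 with i |-> x].

Lemma singleE i x j : single i x j = if j == i then x else 0.
Proof. by rewrite fsfun_withE fsm0E. Qed.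

Lemma single_linear i : linear (single i).
Proof.
move=> a x y; apply/fsfunP => j; rewrite fsmD fsmZ !singleE.
by case: ifP; rewrite ?scaler0 ?addr0.
Qed.

HB.instance Definition _ i :=
  GRing.isLinear.Build K M (fsmod I M) _ (single i) (single_linear i).

Lemma fsm_sum_supp (N : zmodType) (F : I -> M -> N) f (S : {fset I}) :
  (forall i, F i 0 = 0) -> (finsupp f `<=` S)%fset ->
  \sum_(i <- finsupp f) F i (f i) = \sum_(i <- S) F i (f i).
Proof.
move=> F0 fS; apply: (@big_fset_incl _ _ _ _ _ _ (fun i => F i (f i)) fS).
by move=> i _ /fsfun_dflt->.
Qed.

Lemma fsm_sum_linear (N : lmodType K) (F : I -> M -> N) :
  (forall i, linear (F i)) ->
  linear (fun f : fsmod I M => \sum_(i <- finsupp f) F i (f i)).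
Proof.
move=> lF a f g; have F0 i : F i 0 = 0.
  by have := lF i (-1) 0 0; rewrite scaler0 addr0 scaleN1r addNr.
pose S := (finsupp f `|` finsupp g `|` finsupp (a *: f + g)%R)%fset.
have sf : (finsupp f `<=` S)%fset by rewrite /S -fsetUA fsubsetUl.
have sg : (finsupp g `<=` S)%fset by rewrite /S fsubsetU // fsubsetUr.
have sh : (finsupp (a *: f + g)%R `<=` S)%fset by rewrite fsubsetUr.
rewrite (fsm_sum_supp F0 sf) (fsm_sum_supp F0 sg) (fsm_sum_supp F0 sh).
rewrite scaler_sumr -big_split /=; apply: eq_bigr => i _.
by rewrite fsmD fsmZ lF.
Qed.

Lemma fsm_sum_single (N : zmodType) (F : I -> M -> N) i x :
  (forall i, F i 0 = 0) ->
  \sum_(j <- finsupp (single i x)) F j (single i x j) = F i x.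
Proof.
move=> F0; rewrite (@fsm_sum_supp _ _ _ [fset i]%fset) //.
  by rewrite big_seq_fset1 singleE eqxx.
apply/fsubsetP => j; rewrite mem_finsupp singleE inE.
by case: (j == i); rewrite ?eqxx.
Qed.

Lemma fsm_single_sum f : f = \sum_(i <- finsupp f) single i (f i).
Proof.
apply/fsfunP => j; rewrite fsm_sum.
have E (F := fun i x => single i x j) :
    \sum_(i <- finsupp f) F i (f i) = \sum_(i <- (j |` finsupp f)%fset) F i (f i).
  apply: fsm_sum_supp; last exact: fsubsetUr.
  by move=> i; rewrite /F singleE; case: ifP.
rewrite E (big_fsetD1 j) /= ?fset1U1 // singleE eqxx.
rewrite big_seq big1 ?addr0 // => i; rewrite !inE singleE.
by case: (eqVneq i j) => //= nij; rewrite eq_sym (negPf nij).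
Qed.

Lemma fsm_ind (P : fsmod I M -> Prop) :
  P 0 -> (forall f g, P f -> P g -> P (f + g)) ->
  (forall i x, P (single i x)) -> forall f, P f.
Proof.
move=> P0 PD P1 f; rewrite (fsm_single_sum f).
by elim/big_rec: _ => // i g _ Pg; apply: PD.
Qed.

End FsMod.

Arguments single {K I M} i x.

(* a (x) K[t, t^-1]: the function f stands for \sum_n f(n) (x) t^n. *)
Definition loop (K : fieldType) (a : lieAlgType K) := fsmod int a.

Section Loop.
Context {K : fieldType} {a : lieAlgType K}.

HB.instance Definition _ := GRing.Lmodule.on (loop a).

Implicit Types f g h : loop a.

Definition tens (x : a) (n : int) : loop a := single n x.

Definition loop_lie f g : loop a :=
  \sum_(m <- finsupp f) \sum_(n <- finsupp g) tens (lie (f m) (g n)) (m + n).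

Lemma tensD x y n : tens (x + y) n = tens x n + tens y n.
Proof. exact: raddfD. Qed.
Lemma tens0 n : tens 0 n = 0. Proof. exact: raddf0. Qed.
Lemma tensZ c x n : tens (c *: x) n = c *: tens x n.
Proof. exact: linearZ. Qed.

Lemma loop_lie_linearl g : linear (loop_lie^~ g).
Proof.
apply: (fsm_sum_linear
  (F := fun m x => \sum_(n <- finsupp g) tens (lie x (g n)) (m + n))).
move=> m c x y; rewrite scaler_sumr -big_split; apply: eq_bigr => n _ /=.
by rewrite lieDl lieZl tensD tensZ.
Qed.

Lemma loop_lie_linearr f : linear (loop_lie f).
Proof.
move=> c g h; rewrite /loop_lie scaler_sumr -big_split.
apply: eq_bigr => m _ /=.
apply: (fsm_sum_linear (F := fun n x => tens (lie (f m) x) (m + n))).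
by move=> n d x y; rewrite lieDr lieZr tensD tensZ.
Qed.

Lemma loop_lie_tens x m y n :
  loop_lie (tens x m) (tens y n) = tens (lie x y) (m + n).
Proof.
pose F k u := \sum_(l <- finsupp (tens y n)) tens (lie u (tens y n l)) (k + l).
rewrite /loop_lie (fsm_sum_single (F := F)) /F; last first.
  by move=> i; rewrite big1 // => l _; rewrite lie0l tens0.
rewrite (fsm_sum_single (F := fun l u => tens (lie x u) (m + l))) // => i.
by rewrite lie0r tens0.
Qed.

Let loopDl f g h : loop_lie (f + g) h = loop_lie f h + loop_lie g h.
Proof. by have := loop_lie_linearl h 1 f g; rewrite !scale1r. Qed.
Let loopDr f g h : loop_lie h (f + g) = loop_lie h f + loop_lie h g.
Proof. by have := loop_lie_linearr h 1 f g; rewrite !scale1r. Qed.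
Let loop0l h : loop_lie 0 h = 0.
Proof. by apply: (addrI (loop_lie 0 h)); rewrite -loopDl !addr0. Qed.
Let loop0r h : loop_lie h 0 = 0.
Proof. by apply: (addrI (loop_lie h 0)); rewrite -loopDr !addr0. Qed.

Lemma loop_lie_anti f g : loop_lie f g + loop_lie g f = 0.
Proof.
elim/(@fsm_ind K int a): f => [|f1 f2 h1 h2|m x]; first by rewrite loop0l loop0r addr0.
  by rewrite loopDl loopDr addrACA h1 h2 addr0.
elim/(@fsm_ind K int a): g => [|f1 f2 h1 h2|n y]; first by rewrite loop0l loop0r addr0.
  by rewrite loopDl loopDr addrACA h1 h2 addr0.
by rewrite !loop_lie_tens [(n + m)%R]addrC -tensD lieC addNr tens0.
Qed.

Lemma loop_liexx f : loop_lie f f = 0.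
Proof.
elim/(@fsm_ind K int a): f => [|f1 f2 h1 h2|m x]; first exact: loop0l.
  by rewrite loopDl !loopDr h1 h2 add0r addr0 loop_lie_anti.
by rewrite loop_lie_tens liexx tens0.
Qed.

Let jac f g h := loop_lie f (loop_lie g h) + loop_lie g (loop_lie h f) +
  loop_lie h (loop_lie f g).

Let jacC f g h : jac f g h = jac g h f.
Proof. by rewrite /jac [RHS]addrC addrA. Qed.

Let jac0 g h : jac 0 g h = 0.
Proof. by rewrite /jac !(loop0l, loop0r) !addr0. Qed.

Let jacD f f' g h : jac (f + f') g h = jac f g h + jac f' g h.
Proof.
by rewrite /jac !(loopDl, loopDr) [RHS]addrACA [X in _ = X + _]addrACA.
Qed.

Lemma loop_lie_jacobi f g h : loop_lie f (loop_lie g h) +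
  loop_lie g (loop_lie h f) + loop_lie h (loop_lie f g) = 0.
Proof.
rewrite -/(jac f g h).
elim/(@fsm_ind K int a): f => [|f1 f2 e1 e2|m x]; first exact: jac0.
  by rewrite jacD e1 e2 addr0.
rewrite jacC; elim/(@fsm_ind K int a): g => [|f1 f2 e1 e2|n y]; first exact: jac0.
  by rewrite jacD e1 e2 addr0.
rewrite jacC; elim/(@fsm_ind K int a): h => [|f1 f2 e1 e2|p z]; first exact: jac0.
  by rewrite jacD e1 e2 addr0.
rewrite jacC /jac !loop_lie_tens.
have -> : (n + (p + m) = m + (n + p))%R by rewrite addrA addrC.
have -> : (p + (m + n) = m + (n + p))%R by rewrite addrCA [(p + n)%R]addrC.
by rewrite -!tensD lie_jacobi tens0.
Qed.

HB.instance Definition _ := Lmodule_isLieAlgebra.Build K (loop a)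
  loop_lie_linearl loop_lie_linearr loop_liexx loop_lie_jacobi.

Lemma lie_tens x m y n : lie (tens x m) (tens y n) = tens (lie x y) (m + n).
Proof. exact: loop_lie_tens. Qed.

(* The derivation t d/dt. *)
Definition loop_deg f : loop a := \sum_(n <- finsupp f) tens (n%:~R *: f n) n.

Lemma loop_deg_linear : linear loop_deg.
Proof.
apply: (fsm_sum_linear (F := fun n x => tens (n%:~R *: x) n)).
by move=> n c x y; rewrite scalerDr scalerA mulrC -scalerA tensD tensZ.
Qed.

Lemma loop_deg_tens x n : loop_deg (tens x n) = tens (n%:~R *: x) n.
Proof.
rewrite /loop_deg (fsm_sum_single (F := fun n x => tens (n%:~R *: x) n)) //.
by move=> i; rewrite scaler0 tens0.
Qed.

Let degD f g : loop_deg (f + g) = loop_deg f + loop_deg g.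
Proof. by have := loop_deg_linear 1 f g; rewrite !scale1r. Qed.
Let deg0 : loop_deg 0 = 0.
Proof. by apply: (addrI (loop_deg 0)); rewrite -degD !addr0. Qed.

Lemma loop_degD f g : loop_deg (f + g) = loop_deg f + loop_deg g.
Proof. exact: degD. Qed.
Lemma loop_degZ c f : loop_deg (c *: f) = c *: loop_deg f.
Proof. by have := loop_deg_linear c f 0; rewrite !addr0 deg0 addr0. Qed.

Lemma loop_deg_lie f g :
  loop_deg (lie f g) = lie (loop_deg f) g + lie f (loop_deg g).
Proof.
elim/(@fsm_ind K int a): f => [|f1 f2 h1 h2|m x].
- by rewrite deg0 !lie0l deg0 addr0.
- by rewrite degD !lieDl degD h1 h2 addrACA.
elim/(@fsm_ind K int a): g => [|f1 f2 h1 h2|n y].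
- by rewrite deg0 !lie0r deg0 addr0.
- by rewrite degD !lieDr degD h1 h2 addrACA.
rewrite -!/(tens _ _) lie_tens !loop_deg_tens !lie_tens.
by rewrite -tensD lieZl lieZr -scalerDl intrD.
Qed.

End Loop.

Lemma abel4 (V : zmodType) (u1 u2 v1 v2 w1 w2 : V) :
  u1 + u2 + (v1 + v2 + (- w1 - w2)) = u1 + (v1 - w1) + (u2 + (v2 - w2)).
Proof. by rewrite [RHS]addrACA [v1 - w1 + _]addrACA. Qed.

Lemma abel_jac (V : zmodType) (A1 A2 A3 x1 x2 x3 x4 x5 x6 s1 s2 s3 : V) :
  A1 + A2 + A3 = 0 ->
  A1 + (x1 - x2) + (- x6 + x4 + (s1 - s2)) +
  (A2 + (x3 - x4) + (- x1 + x5 + (s3 - s1))) +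
  (A3 + (x6 - x5) + (- x3 + x2 + (s2 - s3))) = 0.
Proof.
move=> A0; rewrite !addrA.
rewrite [LHS](ACl ((1*8*15)*(2*11)*(19*3)*(16*4)*(5*10)*(9*18)*(12*17)*(6*14)*
  (20*7)*(13*21))) /=.
by rewrite A0 !subrr !addr0.
Qed.

(* L(a) (+) K d: the pair (f, c) stands for f + c d. *)
Definition extloop (K : fieldType) (a : lieAlgType K) : Type :=
  (loop a * K^o)%type.

Section ExtLoop.
Context {K : fieldType} {a : lieAlgType K}.

HB.instance Definition _ := GRing.Lmodule.copy (extloop a) (loop a * K^o)%type.

Implicit Types x y z : extloop a.

Definition dcoef x : K := x.2.

Definition extloop_lie x y : extloop a :=
  (lie x.1 y.1 + (dcoef x *: loop_deg y.1 - dcoef y *: loop_deg x.1), 0).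

Fact extloop_lie_linearl z : linear (extloop_lie^~ z).
Proof.
move=> c x y; congr pair; last by rewrite /= scaler0 addr0.
rewrite [(_ + _).1]/(c *: x.1 + y.1) [dcoef (_ + _)]/(c * dcoef x + dcoef y).
rewrite [(_ *: _).1]/= loop_deg_linear lieDl lieZl scalerDl -scalerA.
rewrite !scalerDr !opprD !scalerN [dcoef z *: (c *: _)]scalerA.
rewrite [dcoef z * c]mulrC -[(c * dcoef z) *: _]scalerA.
exact: abel4.
Qed.

Fact extloop_liexx x : extloop_lie x x = 0.
Proof. by congr pair; rewrite liexx subrr addr0. Qed.

Fact extloop_lieC x y : extloop_lie x y = - extloop_lie y x.
Proof.
congr pair; last by rewrite /= oppr0.
by rewrite [LHS]/= lieC -opprB -opprD.
Qed.

Fact extloop_lie_linearr z : linear (extloop_lie z).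
Proof.
move=> c x y; rewrite extloop_lieC extloop_lie_linearl opprD -scalerN.
by rewrite -!extloop_lieC.
Qed.

Fact extloop_lie_piece (f g h : loop a) (p q r : K) :
  lie f (lie g h + (q *: loop_deg h - r *: loop_deg g)) +
  (p *: loop_deg (lie g h + (q *: loop_deg h - r *: loop_deg g)) -
   0 *: loop_deg f) =
  lie f (lie g h) + (q *: lie f (loop_deg h) - r *: lie f (loop_deg g)) +
  (- (p *: lie h (loop_deg g)) + p *: lie g (loop_deg h) +
   ((p * q) *: loop_deg (loop_deg h) - (r * p) *: loop_deg (loop_deg g))).
Proof.
rewrite scale0r subr0 -!scaleNr !lieDr !lieZr !loop_degD !loop_degZ.
rewrite loop_deg_lie (lieC (loop_deg g) h) !scalerDr scalerN !scalerA mulrN.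
by rewrite [p * r]mulrC -!scaleNr.
Qed.

Fact extloop_lie_jacobi x y z : extloop_lie x (extloop_lie y z) +
  extloop_lie y (extloop_lie z x) + extloop_lie z (extloop_lie x y) = 0.
Proof.
congr pair; last by rewrite /= !addr0.
rewrite [LHS]/= !extloop_lie_piece; apply: abel_jac; exact: lie_jacobi.
Qed.

HB.instance Definition _ := Lmodule_isLieAlgebra.Build K (extloop a)
  extloop_lie_linearl extloop_lie_linearr extloop_liexx extloop_lie_jacobi.

(* L(b) and L^e(b) inside L^e(a), for a subspace b of a. *)
Definition Lsub (b : set a) : set (extloop a) :=
  [set x : extloop a | dcoef x = 0 /\ forall n, b (x.1 n)].
Definition Lesub (b : set a) : set (extloop a) :=
  [set x : extloop a | forall n, b (x.1 n)].

End ExtLoop.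

(* The element x (x) t^n + c d of L^e(a). *)
Definition etens (K : fieldType) (a : lieAlgType K) (x : a) (n : int) (c : K) :
  extloop a := (tens x n, c).

Record lieModule (K : fieldType) (L : lieAlgType K) := LieModule {
  mod_sort :> lmodType K;
  act : L -> mod_sort -> mod_sort;
  act_linearl : forall v, linear (act^~ v);
  act_linearr : forall x, linear (act x);
  act_lie : forall x y v, act (lie x y) v = act x (act y v) - act y (act x v)
}.

Section Modules.
Context {K : fieldType} {L : lieAlgType K}.
Implicit Types M N : lieModule L.

Lemma actDr M x (u v : M) : act x (u + v) = act x u + act x v.
Proof. by have := act_linearr x 1 u v; rewrite !scale1r. Qed.
Lemma act0r M x : act x (0 : M) = 0.
Proof. by apply: (addrI (act x (0 : M))); rewrite -actDr !addr0. Qed.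
Lemma actZr M x c (v : M) : act x (c *: v) = c *: act x v.
Proof. by have := act_linearr x c v 0; rewrite !addr0 act0r addr0. Qed.
Lemma actBr M x (u v : M) : act x (u - v) = act x u - act x v.
Proof. by rewrite actDr -scaleN1r actZr scaleN1r. Qed.

Definition mod_isom M N : Prop :=
  exists f : {linear M -> N},
    bijective f /\ forall x v, f (act x v) = act x (f v).

(* Submodules are boolean predicates so that they can carry the library's
   subtype and quotient structures; classically this is no restriction. *)
Record submodule M := Submodule {
  sub_pred :> {pred M};
  sub_closed : submod_closed sub_pred;
  sub_stable : forall x v, v \in sub_pred -> act x v \in sub_pred
}.

HB.instance Definition _ M (A : submodule M) :=
  GRing.isSubmodClosed.Build K M (sub_pred A) (sub_closed A).

Section SubModule.
Variables (M : lieModule L) (A : submodule M).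

Definition sub_sort := {v : M | v \in sub_pred A}.

HB.instance Definition _ := SubChoice.on sub_sort.
HB.instance Definition _ := [SubChoice_isSubLmodule of sub_sort by <:].

Definition sub_act (x : L) (v : sub_sort) : sub_sort :=
  exist _ (act x (val v)) (sub_stable x (valP v)).

Fact sub_act_linearl v : linear (sub_act^~ v).
Proof. by move=> c x y; apply/val_inj; rewrite /= act_linearl. Qed.
Fact sub_act_linearr x : linear (sub_act x).
Proof. by move=> c u v; apply/val_inj; rewrite /= act_linearr. Qed.
Fact sub_act_lie x y v :
  sub_act (lie x y) v = sub_act x (sub_act y v) - sub_act y (sub_act x v).
Proof. by apply/val_inj; rewrite /= act_lie. Qed.

Definition sub_mod : lieModule L :=
  LieModule sub_act_linearl sub_act_linearr sub_act_lie.

End SubModule.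

Section QuotModule.
Variables (M : lieModule L) (A : submodule M).

Definition quot_sort := Quotient.quot (sub_pred A).

HB.instance Definition _ := Choice.on quot_sort.
HB.instance Definition _ := GRing.Zmodule.on quot_sort.
HB.instance Definition _ := EqQuotient.on quot_sort.

Local Open Scope quotient_scope.

Definition quot_pi (v : M) : quot_sort := \pi_(Quotient.quot (sub_pred A)) v.
Local Notation pi := quot_pi.

Lemma quot_piP u v : (pi u = pi v) <-> (u - v \in sub_pred A).
Proof.
by rewrite Quotient.idealrBE; split => [h|/eqP //]; exact/eqP.
Qed.

Lemma quot_piD u v : pi (u + v) = pi u + pi v.
Proof. exact: (Quotient.pi_add (sub_pred A)). Qed.

Lemma quot_ind (P : quot_sort -> Prop) : (forall v, P (pi v)) -> forall q, P q.
Proof. by move=> Ppi q; rewrite -[q](reprK (qT := quot_sort)); exact: Ppi. Qed.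

Definition quot_lift (F : M -> M) (q : quot_sort) : quot_sort := pi (F (repr q)).

Lemma quot_lift_pi F v : (forall u w, F (u - w) = F u - F w) ->
  (forall u, u \in sub_pred A -> F u \in sub_pred A) ->
  quot_lift F (pi v) = pi (F v).
Proof.
move=> FB FA; apply/quot_piP; rewrite -FB; apply: FA.
by apply/quot_piP; exact: (reprK (qT := quot_sort)).
Qed.

Definition quot_scale (c : K) := quot_lift ( *:%R c).

Lemma quot_scale_pi c v : quot_scale c (pi v) = pi (c *: v).
Proof.
apply: quot_lift_pi => [u w|u]; first exact: scalerBr.
exact: rpredZ.
Qed.

Fact quot_scaleA b c q : quot_scale b (quot_scale c q) = quot_scale (b * c) q.
Proof. by elim/quot_ind: q => v; rewrite !quot_scale_pi scalerA. Qed.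
Fact quot_scale1 : left_id 1 quot_scale.
Proof. by elim/quot_ind => v; rewrite quot_scale_pi scale1r. Qed.
Fact quot_scaleDr : right_distributive quot_scale +%R.
Proof.
move=> c; elim/quot_ind => u; elim/quot_ind => v.
by rewrite -quot_piD !quot_scale_pi scalerDr quot_piD.
Qed.
Fact quot_scaleDl q : {morph quot_scale^~ q : b c / b + c}.
Proof.
by move=> b c; elim/quot_ind: q => v; rewrite !quot_scale_pi scalerDl quot_piD.
Qed.

HB.instance Definition _ := GRing.Zmodule_isLmodule.Build K quot_sort
  quot_scaleA quot_scale1 quot_scaleDr quot_scaleDl.

Lemma quot_piZ c v : pi (c *: v) = c *: pi v.
Proof. by rewrite -quot_scale_pi. Qed.

Definition quot_act (x : L) := quot_lift (act x).

Lemma quot_act_pi x v : quot_act x (pi v) = pi (act x v).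
Proof. apply: quot_lift_pi => [u w|u]; [exact: actBr|exact: sub_stable]. Qed.

Fact quot_act_linearl q : linear (quot_act^~ q).
Proof.
move=> c x y; elim/quot_ind: q => v.
by rewrite !quot_act_pi act_linearl quot_piD quot_piZ.
Qed.
Fact quot_act_linearr x : linear (quot_act x).
Proof.
move=> c; elim/quot_ind => u; elim/quot_ind => v.
by rewrite -quot_piZ -quot_piD !quot_act_pi act_linearr quot_piD quot_piZ.
Qed.
Fact quot_act_lie x y q :
  quot_act (lie x y) q = quot_act x (quot_act y q) - quot_act y (quot_act x q).
Proof.
elim/quot_ind: q => v; rewrite !quot_act_pi act_lie.
by rewrite -scaleN1r quot_piD quot_piZ scaleN1r.
Qed.

Definition quot_mod : lieModule L :=
  LieModule quot_act_linearl quot_act_linearr quot_act_lie.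

End QuotModule.

Section SubQuotient.
Variables (M : lieModule L) (A B : submodule M).

Definition restr_pred : {pred sub_mod A} := fun v => val v \in sub_pred B.

Fact restr_closed : submod_closed restr_pred.
Proof.
split; first by rewrite /restr_pred unfold_in /= rpred0.
by move=> c u v uB vB; rewrite unfold_in /= rpredD // rpredZ.
Qed.
Fact restr_stable x v : v \in restr_pred -> act x v \in restr_pred.
Proof. exact: sub_stable. Qed.

(* A / B when B is contained in A. *)
Definition subquot : lieModule L :=
  quot_mod (Submodule restr_closed restr_stable).

End SubQuotient.

End Modules.

Definition lspan (K : fieldType) (E : lmodType K) (W : set E) : set E :=
  [set v | exists n (c : 'I_n -> K) (w : 'I_n -> E),
     (forall i, W (w i)) /\ v = \sum_i c i *: w i].

Section LinearNotions.
Context {K : fieldType} {L : lieAlgType K} {M : lieModule L}.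
Implicit Types (W A B : set M) (S : set L).

Definition dim_le (n : nat) W : Prop :=
  exists u : 'I_n -> M, W `<=` [set v | exists c : 'I_n -> K,
    v = \sum_i c i *: u i].

Definition nonzero W : Prop := exists2 v, W v & v != 0.

(* U(S) v for a subalgebra S: the enveloping algebra U(S) is spanned by the
   monomials x_1 ... x_k with x_i in S. *)
Definition Usub S (v : M) : set M :=
  lspan [set w | exists s : seq L,
    (forall x, x \in s -> S x) /\ w = foldr (@act _ _ M) v s].

Definition stable_subspace S A : Prop :=
  [/\ A 0, forall c u v, A u -> A v -> A (c *: u + v)
    & forall x v, S x -> A v -> A (act x v)].

Definition indecomposable_over S W : Prop :=
  nonzero W /\
  forall A B, stable_subspace S A -> stable_subspace S B ->
    A `<=` W -> B `<=` W ->
    (forall w, W w -> exists a b, [/\ A a, B b & w = a + b]) ->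
    A `&` B `<=` [set 0] ->
    A `<=` [set 0] \/ B `<=` [set 0].

Definition is_direct_sum (I : choiceType) (W : I -> set M) : Prop :=
  forall v : M, exists! f : fsmod I M,
    (forall i, W i (f i)) /\ v = \sum_(i <- finsupp f) f i.

End LinearNotions.

Definition indecomposable (K : fieldType) (L : lieAlgType K)
  (M : lieModule L) : Prop := indecomposable_over setT [set: M].

Definition simple_module (K : fieldType) (L : lieAlgType K)
  (M : lieModule L) : Prop :=
  nonzero [set: M] /\
  forall A : set M, stable_subspace setT A -> A `<=` [set 0] \/ A = setT.

Section Roots.
Context {K : fieldType} {g : finLieAlgType K}.

Definition simple_lie : Prop :=
  (exists x y : g, lie x y != 0) /\
  forall I : {vspace g}, (forall x y, y \in I -> lie x y \in I) ->
    I = 0%VS \/ I = fullv.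

(* A nilpotent self-normalising subalgebra; nilpotency: all sufficiently long
   iterated brackets [x_1, [x_2, ... [x_n, y]]] vanish. *)
Definition is_cartan (h : {vspace g}) : Prop :=
  [/\ forall x y, x \in h -> y \in h -> lie x y \in h,
      exists n, forall (s : seq g) y, size s = n ->
        {subset s <= h} -> y \in h -> foldr lie y s = 0
    & forall x, (forall y, y \in h -> lie x y \in h) -> x \in h].

Definition dual (h : {vspace g}) := 'Hom(subvs_of h, K^o).

Section Cartan.
Context {h : {vspace g}}.
Implicit Types alpha : dual h.

Definition rootspace alpha : set g :=
  [set x | forall y : subvs_of h, lie (vsval y) x = (alpha y : K) *: x].

Definition is_root alpha : Prop :=
  alpha != 0 /\ exists2 x, rootspace alpha x & x != 0.

(* y is the coroot of alpha, i.e. the element of [g_alpha, g_(-alpha)] with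
   alpha(y) = 2; root spaces being lines, [g_alpha, g_(-alpha)] consists of
   single brackets. *)
Definition is_coroot alpha (y : subvs_of h) : Prop :=
  (exists x x', [/\ rootspace alpha x, rootspace (- alpha) x'
     & vsval y = lie x x']) /\ (alpha y : K) = 2.

(* Rp is the set of positive roots with respect to some base (simple roots). *)
Definition positive_system (Rp : set (dual h)) : Prop :=
  exists D : seq (dual h),
    [/\ basis_of fullv D, forall alpha, alpha \in D -> is_root alpha,
        forall alpha, is_root alpha -> exists c : nat -> nat,
          alpha = \sum_(i < size D) D`_i *+ c i \/
          alpha = - \sum_(i < size D) D`_i *+ c i
      & forall alpha, Rp alpha <-> is_root alpha /\
          exists c : nat -> nat, alpha = \sum_(i < size D) D`_i *+ c i].

End Cartan.
End Roots.

Arguments simple_lie {K} g.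

Record rootDatum (K : fieldType) (g : finLieAlgType K) := RootDatum {
  cartan : {vspace g};
  cartanP : is_cartan cartan;
  posroot : set (dual cartan);
  posrootP : positive_system posroot;
  xplus : dual cartan -> g;
  xminus : dual cartan -> g;
  xplusP : forall alpha, posroot alpha ->
    rootspace alpha (xplus alpha) /\ xplus alpha != 0;
  xminusP : forall alpha, posroot alpha ->
    rootspace (- alpha) (xminus alpha) /\ xminus alpha != 0
}.

Arguments posroot {K g} r _.
Arguments xplus {K g} r _.
Arguments xminus {K g} r _.

Section Weights.
Context {K : fieldType} {g : finLieAlgType K} (rd : rootDatum g).
Local Notation h := (cartan rd).

Definition nplus : set g :=
  lspan [set x | exists2 alpha, posroot rd alpha & rootspace alpha x].

Definition weight_lattice : set (dual h) :=
  [set lam | forall alpha y, is_root alpha -> is_coroot alpha y ->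
     exists n : int, (lam y : K) = n%:~R].
Definition dominant_weights : set (dual h) :=
  [set lam | weight_lattice lam /\
     forall alpha y, posroot rd alpha -> is_coroot alpha y ->
       exists n : nat, (lam y : K) = n%:R].

(* The dual of h_e = h (+) K d, identified with h^* (+) K delta. *)
Definition eweight := (dual h * K)%type.

Definition delta : eweight := (0, 1).
Definition Zdelta : set eweight := [set mu | exists r : int, mu = delta *~ r].
Definition Pe : set eweight :=
  [set mu | weight_lattice mu.1 /\ exists r : int, mu.2 = r%:~R].
Definition Peplus : set eweight :=
  [set mu | dominant_weights mu.1 /\ exists r : int, mu.2 = r%:~R].

Implicit Types M : lieModule (extloop g).

Definition weight_space M (mu : eweight) : set M :=
  [set v | forall (y : subvs_of h) (c : K),
     act (etens (vsval y) 0 c) v = ((mu.1 y : K) + c * mu.2) *: v].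

Definition wte M : set eweight := [set mu | nonzero (@weight_space M mu)].

Definition locally_nilpotent M (x : extloop g) : Prop :=
  forall v : M, exists n, iter n (act x) v = 0.

Definition integrable M : Prop :=
  is_direct_sum (@weight_space M) /\
  forall alpha, posroot rd alpha -> forall s : int,
    locally_nilpotent M (etens (xplus rd alpha) s 0) /\
    locally_nilpotent M (etens (xminus rd alpha) s 0).

Definition Ifin M : Prop :=
  [/\ integrable M, wte M `<=` Pe
    & forall mu, exists n, dim_le n (@weight_space M mu)].

Definition Lnplus : set (extloop g) := Lsub nplus.
Definition Leh : set (extloop g) := Lesub [set x : g | x \in h].

Definition Vplus M (lam : eweight) : set M :=
  [set v | weight_space lam v /\ forall x, Lnplus x -> act x v = 0].

Definition lhighest_vector M (v : M) : Prop :=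
  v != 0 /\ exists lam : eweight,
    [/\ Peplus lam, ~ Zdelta lam, Vplus lam v,
        indecomposable_over Leh (Usub Leh v)
      & forall r : int,
          dim_le 1 (Usub Leh v `&` weight_space (lam + delta *~ r))].

Definition lhighest M : Prop :=
  exists2 v : M, lhighest_vector v & Usub setT v = setT.

End Weights.

Arguments Zdelta {K g} rd _.
Arguments wte {K g} rd M _.

Section Trivial.
Context {K : fieldType} {g : finLieAlgType K}.

Definition Cdelta_act (r : int) (x : extloop g) (z : K^o) : K^o :=
  (dcoef x * r%:~R) *: z.

Fact Cdelta_linearl r z : linear ((Cdelta_act r)^~ z).
Proof.
move=> c x y; rewrite /Cdelta_act.
rewrite [dcoef (_ + _)]/(c * dcoef x + dcoef y).
by rewrite mulrDl -mulrA scalerDl -scalerA.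
Qed.
Fact Cdelta_linearr r x : linear (Cdelta_act r x).
Proof.
by move=> c u v; rewrite /Cdelta_act scalerDr !scalerA [c * _]mulrC.
Qed.
Fact Cdelta_lie r x y z : Cdelta_act r (lie x y) z =
  Cdelta_act r x (Cdelta_act r y z) - Cdelta_act r y (Cdelta_act r x z).
Proof.
rewrite /Cdelta_act [dcoef (lie _ _)]/(0 : K) !scalerA.
by rewrite [X in _ - X *: _]mulrC subrr mul0r scale0r.
Qed.

Definition Cdelta (r : int) : lieModule (extloop g) :=
  LieModule (Cdelta_linearl r) (Cdelta_linearr r) (@Cdelta_lie r).

(* \bigoplus_(r in Z) (C_(r delta))^(m r): finitely supported families indexed
   by the pairs (r, i) with i < m r, with componentwise action. *)
Section DirectSum.
Variable m : int -> nat.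

Definition triv_index := {r : int & 'I_(m r)}.
Definition triv_sort := fsmod triv_index K^o.

Definition triv_act (x : extloop g) (f : triv_sort) : triv_sort :=
  [fsfun i in finsupp f => act x (f i : Cdelta (tag i)) | 0].

Lemma triv_actE x f i : triv_act x f i = act x (f i : Cdelta (tag i)).
Proof.
rewrite fsfunE; case: ifPn => // /fsfun_dflt ->.
by rewrite (@act0r _ _ (Cdelta (tag i))).
Qed.

Fact triv_linearl f : linear (triv_act^~ f).
Proof.
move=> c x y; apply/fsfunP => i; rewrite fsmD fsmZ !triv_actE.
exact: (@act_linearl _ _ (Cdelta (tag i))).
Qed.
Fact triv_linearr x : linear (triv_act x).
Proof.
move=> c u v; apply/fsfunP => i; rewrite fsmD fsmZ !triv_actE fsmD fsmZ.
exact: (@act_linearr _ _ (Cdelta (tag i))).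
Qed.
Fact triv_lie x y f :
  triv_act (lie x y) f = triv_act x (triv_act y f) - triv_act y (triv_act x f).
Proof.
apply/fsfunP => i; rewrite fsmD fsmN !triv_actE.
exact: (@act_lie _ _ (Cdelta (tag i))).
Qed.

Definition triv_sum : lieModule (extloop g) :=
  LieModule triv_linearl triv_linearr triv_lie.

End DirectSum.
End Trivial.

Section Series.
Context {K : fieldType} {g : finLieAlgType K} (rd : rootDatum g).
Implicit Types V : lieModule (extloop g).

(* Only the terms of index 0, ..., flen are relevant. *)
Record filtration (L : lieAlgType K) (V : lieModule L) := Filtration {
  flen : nat;
  fterm : nat -> submodule V;
  fterm_bot : forall v, v \in fterm 0 -> v = 0;
  fterm_top : forall v, v \in fterm flen;
  fterm_mono : forall k, (k < flen)%N -> {subset fterm k <= fterm k.+1}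
}.

(* The k-th quotient, 0 <= k < flen F, is V_(k+1) / V_k. *)
Definition fquot (L : lieAlgType K) (V : lieModule L) (F : filtration V)
  (k : nat) : lieModule L := subquot (fterm F k.+1) (fterm F k).

Definition nontrivial_factor V : Prop := ~ (wte rd V `<=` Zdelta rd).

Definition simple_lhighest V : Prop :=
  [/\ simple_module V, lhighest rd V & nontrivial_factor V].

Definition is_trivial_sum V : Prop :=
  exists m : int -> nat, mod_isom V (triv_sum m).

Definition pseudo_JH V (F : filtration V) : Prop :=
  [/\ forall k, (k < flen F)%N -> ~ {subset fterm F k.+1 <= fterm F k},
      forall k, (k < flen F)%N ->
        simple_lhighest (fquot F k) \/ is_trivial_sum (fquot F k)
    & forall k, (k.+1 < flen F)%N ->
        ~ (is_trivial_sum (fquot F k) /\ is_trivial_sum (fquot F k.+1))].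

Definition equivalent_filtrations V (F F' : filtration V) : Prop :=
  #|[pred k : 'I_(flen F) | `[< nontrivial_factor (fquot F k) >]]| =
    #|[pred k : 'I_(flen F') | `[< nontrivial_factor (fquot F' k) >]]| /\
  forall i, (i < flen F)%N -> nontrivial_factor (fquot F i) ->
    exists2 j, (j < flen F')%N & mod_isom (fquot F i) (fquot F' j).

End Series.

(* Main.v *)
From HB Require Import structures.
Require Import Defs.
From mathcomp Require Import all_boot all_algebra reals complex.
From mathcomp Require Import finmap boolp classical_sets.

(** The argument is the Zassenhaus-Schreier proof of the Jordan-Hölder theorem,
    carried out modulo the trivial factors, those that are sums of modules
    C_(r delta).

    Let A / B and A' / B' be factors of two filtrations of V.  They are
    _matched_ when A and A' have a common element outside B, and on the
    intersection of A and A' being in B is the same as being in B'.  This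
    relation is symmetric, and a given factor is matched with at most one
    factor of the other filtration ([matched_inj]).

    If A / B is simple with a weight outside Z delta, take the first step
    A' / B' of the other filtration for which the intersection of A and A' is
    not contained in B.  By simplicity A is B plus that intersection.
    If A' / B' were a sum of modules C_(r delta), then h would act by zero on
    A / B and d would be diagonalisable with integer eigenvalues, since A / B
    is a subquotient of A' / B'; all weights of A / B would lie in Z delta
    ([trivial_like_subquot], [trivial_like_wte]).  Hence A' / B' is simple as
    well, and simplicity gives first that the two factors are matched and then
    that both are quotients of the intersection of A and A' by the same
    submodule, so that they are isomorphic ([match_simple], [matched_isom]).
    Matching is therefore a bijection between the nontrivial factors of the
    two series. *)

Set Implicit Arguments.
Unset Strict Implicit.
Unset Printing Implicit Defensive.

Import GRing.Theory.

Local Open Scope ring_scope.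
Local Open Scope classical_set_scope.

(** * Subquotients *)

Section SubquotientTheory.
Context {K : fieldType} {L : lieAlgType K} {M : lieModule L}.
Implicit Types (A B : submodule M) (u v w : M).

(** The class of [v] in A / B; elements outside A are sent to 0. *)
Definition subquot_pi A B v : subquot A B :=
  @quot_pi _ _ (sub_mod A) _ (insubd (0 : sub_sort A) v : sub_sort A).

Lemma subquot_pi_eq A B u v : u \in A -> v \in A ->
  (subquot_pi A B u = subquot_pi A B v) <-> (u - v \in B).
Proof.
move=> uA vA; rewrite /subquot_pi; apply: (iff_trans (quot_piP _ _ _)).
by rewrite /= /in_mem /= /restr_pred /in_mem /= !insubdK.
Qed.

Lemma subquot_piD A B u v : u \in A -> v \in A ->
  subquot_pi A B (u + v) = subquot_pi A B u + subquot_pi A B v.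
Proof.
move=> uA vA; rewrite /subquot_pi -quot_piD; congr (quot_pi _ _).
by apply/val_inj; rewrite /= !insubdK // rpredD.
Qed.

Lemma subquot_piZ A B c v : v \in A ->
  subquot_pi A B (c *: v) = c *: subquot_pi A B v.
Proof.
move=> vA; rewrite /subquot_pi -quot_piZ; congr (quot_pi _ _).
by apply/val_inj; rewrite /= !insubdK // rpredZ.
Qed.

Lemma subquot_pi0 A B : subquot_pi A B 0 = 0.
Proof. by rewrite -[0 in LHS](scale0r 0) subquot_piZ ?rpred0 // scale0r. Qed.

Lemma subquot_pi_eq0 A B v : v \in A -> (subquot_pi A B v = 0) <-> (v \in B).
Proof.
by move=> vA; rewrite -(subquot_pi0 A B) subquot_pi_eq ?rpred0 // subr0.
Qed.

Lemma subquot_pi_act A B x v : v \in A ->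
  subquot_pi A B (act x v) = act x (subquot_pi A B v).
Proof.
move=> vA; rewrite /subquot_pi [RHS]quot_act_pi; congr (quot_pi _ _).
by apply/val_inj; rewrite /= !insubdK // sub_stable.
Qed.

Lemma subquot_piP A B (q : subquot A B) :
  exists2 v, v \in A & q = subquot_pi A B v.
Proof.
move: q; apply: (@quot_ind _ _ (sub_mod A)) => v.
exists (val v); first exact: valP.
by rewrite /subquot_pi valKd.
Qed.

(** A submodule C of M has either zero or full image in a simple A / B. *)
Lemma subquot_simple A B (C : set M) :
  simple_module (subquot A B) -> stable_subspace setT C ->
  (forall v, v \in A -> C v -> v \in B) \/
  (forall v, v \in A -> exists w, [/\ w \in A, C w & v - w \in B]).
Proof.
case=> _ simAB [C0 CD Cact].
pose D : set (subquot A B) :=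
  [set q | exists w, [/\ w \in A, C w & q = subquot_pi A B w]].
case: (simAB D).
- split.
  + by exists 0; rewrite rpred0 subquot_pi0.
  + move=> c _ _ [u [uA Cu ->]] [v [vA Cv ->]]; exists (c *: u + v).
    split; [by rewrite rpredD ?rpredZ | exact: CD |].
    by rewrite subquot_piD ?subquot_piZ ?rpredZ.
  + move=> x _ _ [v [vA Cv ->]]; exists (act x v).
    by split; [exact: sub_stable | exact: Cact | rewrite subquot_pi_act].
- move=> D0; left=> v vA Cv; apply/(subquot_pi_eq0 B vA).
  by apply: D0; exists v.
- move=> DT; right=> v vA.
  have: D (subquot_pi A B v) by rewrite DT.
  by case=> w [wA Cw /subquot_pi_eq vw]; exists w; split=> //; exact: vw.
Qed.

End SubquotientTheory.

Section Comparison.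
Context {K : fieldType} {L : lieAlgType K} {M : lieModule L}.
Variables A B A' B' : submodule M.

Hypothesis genA :
  forall v, v \in A -> exists w, [/\ w \in A, w \in A' & v - w \in B].
Hypothesis genA' :
  forall v, v \in A' -> exists w, [/\ w \in A, w \in A' & v - w \in B'].
Hypothesis sameB : forall w, w \in A -> w \in A' -> (w \in B) = (w \in B').

(** Both A / B and A' / B' are then the quotient of the intersection of A and
    A' by its intersection with B, which is also its intersection with B'. *)
Lemma subquot_isom : mod_isom (subquot A B) (subquot A' B').
Proof.
have repA (q : subquot A B) :
    exists w, [/\ w \in A, w \in A' & q = subquot_pi A B w].
  case: (subquot_piP q) => v vA ->; have [w [wA wA' vw]] := genA vA.
  by exists w; split=> //; apply/subquot_pi_eq.
have repA' (q : subquot A' B') :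
    exists w, [/\ w \in A, w \in A' & q = subquot_pi A' B' w].
  case: (subquot_piP q) => v vA ->; have [w [wA wA' vw]] := genA' vA.
  by exists w; split=> //; apply/subquot_pi_eq.
have [r rP] := choice repA; have [r' r'P] := choice repA'.
(* The map sends the class of an element of both A and A' to its class. *)
pose f q := subquot_pi A' B' (r q); pose f' q := subquot_pi A B (r' q).
have fE w : w \in A -> w \in A' -> f (subquot_pi A B w) = subquot_pi A' B' w.
  move=> wA wA'.
  case: (rP (subquot_pi A B w)) => uA uA' /(subquot_pi_eq B wA uA) wu.
  apply/subquot_pi_eq => //.
  by rewrite -sameB ?(rpredB uA) ?(rpredB uA') // -opprB rpredN.
have f'E w : w \in A -> w \in A' -> f' (subquot_pi A' B' w) = subquot_pi A B w.
  move=> wA wA'.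
  case: (r'P (subquot_pi A' B' w)) => uA uA' /(subquot_pi_eq B' wA' uA') wu.
  apply/subquot_pi_eq => //.
  by rewrite sameB ?(rpredB uA) ?(rpredB uA') // -opprB rpredN.
have f_lin : linear f.
  move=> c p q; case: (repA p) (repA q) => u [uA uA' ->] [v [vA vA' ->]].
  rewrite -subquot_piZ // -subquot_piD ?rpredZ //.
  by rewrite !fE ?rpredD ?rpredZ // subquot_piD ?subquot_piZ ?rpredZ.
pose F := GRing.isLinear.Build K (subquot A B) (subquot A' B') _ f f_lin.
pose fL : {linear subquot A B -> subquot A' B'} := HB.pack f F.
exists fL; split=> [|x q].
  exists f' => q.
    by case: (repA q) => u [uA uA' ->]; rewrite [fL _]fE // f'E.
  by case: (repA' q) => u [uA uA' ->]; rewrite f'E // [fL _]fE.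
case: (repA q) => u [uA uA' ->].
rewrite -subquot_pi_act // ![fL _]fE ?sub_stable //.
by rewrite subquot_pi_act.
Qed.

End Comparison.

(** * Trivial factors *)

Section TrivialFactors.
Context {K : fieldType} {g : finLieAlgType K} (rd : rootDatum g).
Implicit Types M : lieModule (extloop g).

(** The product of the operators d - r, for [r] in [s], applied to [v]. *)
Definition dprod M (s : seq int) (v : M) : M :=
  foldr (fun r u => act (etens 0 0 1) u - r%:~R *: u) v s.

Lemma dprod_cons M r s (v : M) :
  dprod (r :: s) v = act (etens 0 0 1) (dprod s v) - r%:~R *: dprod s v.
Proof. by []. Qed.

(** A property of the sums of modules C_(r delta) that passes to subquotients
    and forces all weights into Z delta. *)
Definition trivial_like M : Prop :=
  forall v : M, (forall y : g, act (etens y 0 0) v = 0) /\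
                exists s, dprod s v = 0.

Lemma trivial_like_wte M : trivial_like M -> wte rd M `<=` Zdelta rd.
Proof.
move=> trM [mu1 mu2] [v vmu v0]; have [hv [s sv]] := trM v.
have h0 : mu1 = 0.
  apply/lfunP => y; rewrite lfunE /=; apply/eqP.
  have /eqP := vmu y 0; rewrite hv mul0r addr0 eq_sym scaler_eq0.
  by rewrite (negPf v0) orbF.
have dv : act (etens 0 0 1) v = mu2 *: v.
  have vs0 : vsval (0 : subvs_of (cartan rd)) = 0 by exact: linear0.
  by have := vmu 0 1; rewrite vs0 h0 lfunE /= mul1r add0r.
(* d acts on [v] by mu2, so mu2 is one of the integers r in [s]. *)
have : \prod_(r <- s) (mu2 - r%:~R) == 0.
  have /eqP := sv; suff -> : dprod s v = \prod_(r <- s) (mu2 - r%:~R) *: v.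
    by rewrite scaler_eq0 (negPf v0) orbF.
  elim: s {sv} => [|r s IHs] /=; first by rewrite big_nil scale1r.
  by rewrite IHs actZr dv big_cons !scalerA -scalerBl mulrBl [mu2 * _]mulrC.
rewrite prodf_seq_eq0 => /hasP[r _] /=; rewrite subr_eq0 => /eqP mu2r.
exists r; rewrite h0 mu2r; apply: injective_projections => /=.
  by rewrite raddfMz /= mul0rz.
by rewrite raddfMz.
Qed.

Lemma triv_sum_trivial_like (m : int -> nat) :
  trivial_like (triv_sum (g := g) m).
Proof.
move=> v; split=> [y|].
  by apply/fsfunP => i; rewrite triv_actE /= /Cdelta_act mul0r scale0r fsm0i.
have dprodE s i : dprod s v i = \prod_(r <- s) ((tag i)%:~R - r%:~R) *: v i.
  elim: s => [|r s IHs]; first by rewrite big_nil scale1r.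
  rewrite dprod_cons fsmD fsmN fsmZ triv_actE /= /Cdelta_act mul1r IHs big_cons.
  by rewrite !scalerA -scalerBl mulrBl.
exists [seq tag i | i <- finsupp v]; apply/fsfunP => i; rewrite fsm0i dprodE.
case: (finsuppP v i) => [|iv]; first by rewrite scaler0.
by rewrite big_map (big_fsetD1 i) //= subrr mul0r scale0r.
Qed.

Lemma trivial_sum_trivial_like M : is_trivial_sum M -> trivial_like M.
Proof.
case=> m [f [/bij_inj f_inj fact]] v.
have [hv [s sv]] := triv_sum_trivial_like (f v).
split=> [y|]; first by apply: f_inj; rewrite fact hv raddf0.
exists s; apply: f_inj; rewrite raddf0 -[RHS]sv.
elim: s {sv} => // r s IHs.
by rewrite !dprod_cons raddfB /= fact linearZ IHs.
Qed.

Lemma trivial_sum_wte M : is_trivial_sum M -> wte rd M `<=` Zdelta rd.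
Proof. by move=> /trivial_sum_trivial_like; exact: trivial_like_wte. Qed.

Variables (V : lieModule (extloop g)) (A B : submodule V).

Lemma dprod_stable (C : submodule V) s v : v \in C -> dprod s v \in C.
Proof.
by move=> vC; elim: s => //= r s IHs; rewrite rpredB ?rpredZ ?sub_stable.
Qed.

Lemma subquot_pi_dprod s v : v \in A ->
  subquot_pi A B (dprod s v) = dprod s (subquot_pi A B v).
Proof.
move=> vA; elim: s => // r s IHs; have wA := dprod_stable s vA.
rewrite !dprod_cons -IHs -scaleN1r subquot_piD ?rpredZ ?sub_stable //.
by rewrite !subquot_piZ ?rpredZ // subquot_pi_act // scaleN1r.
Qed.

End TrivialFactors.

Section TrivialSubquotient.
Context {K : fieldType} {g : finLieAlgType K} (V : lieModule (extloop g)).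
Variables A B A' B' : submodule V.

(** The hypotheses make A / B a subquotient of A' / B'. *)
Lemma trivial_like_subquot :
  (forall v, v \in A -> exists w, [/\ w \in A, w \in A' & v - w \in B]) ->
  (forall w, w \in A -> w \in A' -> w \in B' -> w \in B) ->
  trivial_like (subquot A' B') -> trivial_like (subquot A B).
Proof.
move=> genA subB tr q; case: (subquot_piP q) => v vA ->.
have [w [wA wA' vw]] := genA v vA.
have -> : subquot_pi A B v = subquot_pi A B w by apply/subquot_pi_eq.
have [hw [s sw]] := tr (subquot_pi A' B' w); split=> [y|].
  rewrite -subquot_pi_act //; apply/(subquot_pi_eq0 B (sub_stable _ wA)).
  apply: subB; [exact: sub_stable | exact: sub_stable |].
  by apply/(subquot_pi_eq0 B' (sub_stable _ wA')); rewrite subquot_pi_act.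
exists s; rewrite -subquot_pi_dprod //.
apply/(subquot_pi_eq0 B (dprod_stable _ wA)).
apply: subB; [exact: dprod_stable | exact: dprod_stable |].
by apply/(subquot_pi_eq0 B' (dprod_stable _ wA')); rewrite subquot_pi_dprod.
Qed.

End TrivialSubquotient.

(** * Matching the factors of two filtrations *)

Section Matching.
Context {K : fieldType} {L : lieAlgType K} {V : lieModule L}.
Implicit Types A B : submodule V.

(** Matching of the factors A / B and A' / B': the intersection of A and A'
    meets B and B' in the same submodule, and is not contained in it. *)
Definition matched A B A' B' : Prop :=
  (exists v, [/\ v \in A, v \in A' & v \notin B]) /\
  (forall w, w \in A -> w \in A' -> (w \in B) = (w \in B')).

Lemma matched_sym A B A' B' : matched A B A' B' -> matched A' B' A B.
Proof.
case=> [[v [vA vA' vB]] sameB]; split=> [|w wA' wA]; last by rewrite sameB.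
by exists v; rewrite -sameB.
Qed.

Lemma sum_stable A B (C : submodule V) :
  stable_subspace setT
    [set v | exists w, [/\ w \in A, w \in C & v - w \in B]].
Proof.
split.
- by exists 0; rewrite subr0 !rpred0.
- move=> c u v [u' [uA uC uB]] [v' [vA vC vB]]; exists (c *: u' + v').
  by rewrite opprD addrACA -scalerBr; split; rewrite rpredD ?rpredZ.
- move=> x v _ [w [wA wC vw]]; exists (act x w).
  by rewrite -actBr; split; apply: sub_stable.
Qed.

(** When A / B is simple, A is the sum of B and of any submodule of A that is
    not contained in B, here the intersection of A and C. *)
Lemma sub_sum A B (C : submodule V) : simple_module (subquot A B) ->
  (exists v, [/\ v \in A, v \in C & v \notin B]) ->
  forall v, v \in A -> exists w, [/\ w \in A, w \in C & v - w \in B].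
Proof.
move=> simAB [v [vA vC vB]].
case: (subquot_simple simAB (sum_stable A B C)) => [small|big u uA].
  by case/negP: vB; apply: small => //; exists v; split; rewrite ?subrr ?rpred0.
have [w [wA [w' [w'A w'C ww']] uw]] := big u uA.
by exists w'; split=> //; rewrite -(subrK w u) -addrA rpredD.
Qed.

(** If A' is the first step of a filtration, with predecessor B', whose
    intersection with A is not contained in B, the two factors are matched as
    soon as A' / B' is simple: the image of B in A' / B' is not everything, for
    otherwise the intersection of A and A' would be contained in B. *)
Lemma match_simple A B A' B' :
  {subset B <= A} -> simple_module (subquot A' B') ->
  (exists v, [/\ v \in A, v \in A' & v \notin B]) ->
  (forall w, w \in A -> w \in B' -> w \in B) -> matched A B A' B'.
Proof.
move=> BA simA'B' [v [vA vA' vB]] subB; split; first by exists v.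
move=> w wA wA'; apply/idP/idP => [wB|]; last exact: subB.
apply: contraNT vB => wB'.
have [|u [uA' uB vu]] := sub_sum (C := B) simA'B' _ vA'; first by exists w.
by rewrite -(subrK u v) rpredD // subB // rpredB // BA.
Qed.

Lemma matched_isom A B A' B' : simple_module (subquot A B) ->
  simple_module (subquot A' B') -> matched A B A' B' ->
  mod_isom (subquot A B) (subquot A' B').
Proof.
move=> simAB simA'B' m; case: (m) => exv sameB; apply: subquot_isom sameB.
  exact: sub_sum.
have [exv' _] := matched_sym m.
by move=> v vA'; have [w [wA' wA vw]] := sub_sum simA'B' exv' vA'; exists w.
Qed.

Lemma fterm_le (F : filtration V) i j : (i <= j)%N -> (j <= flen F)%N ->
  {subset fterm F i <= fterm F j}.
Proof.
elim: j => [|j IHj]; first by rewrite leqn0 => /eqP-> _ v.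
rewrite leq_eqVlt => /predU1P[-> _ v //|ij] jF v vi.
by apply: (fterm_mono jF); apply: IHj vi => //; exact: ltnW.
Qed.

(** A common element of A and of the earlier of two steps, outside B, lies in
    the predecessor of the later step: only the earlier one can be matched. *)
Lemma matched_inj A B (F : filtration V) i j :
  (i < flen F)%N -> (j < flen F)%N ->
  matched A B (fterm F i.+1) (fterm F i) ->
  matched A B (fterm F j.+1) (fterm F j) -> i = j.
Proof.
wlog ij : i j / (i <= j)%N.
  move=> W iF jF mi mj; case/orP: (leq_total i j) => ij; first exact: W.
  by symmetry; exact: W.
move=> iF jF [[v [vA vi vB]] _] [_ sameB].
apply/eqP; rewrite eqn_leq ij leqNgt /=; apply: contraNN vB => lt_ij.
have vj : v \in fterm F j by apply: fterm_le vi => //; exact: ltnW.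
by rewrite sameB //; apply: fterm_mono.
Qed.

Lemma first_step A B (F : filtration V) :
  (exists2 v, v \in A & v \notin B) ->
  exists j, [/\ (j < flen F)%N,
    exists v, [/\ v \in A, v \in fterm F j.+1 & v \notin B] &
    forall w, w \in A -> w \in fterm F j -> w \in B].
Proof.
case=> v vA vB.
pose P j := `[< exists v, [/\ v \in A, v \in fterm F j & v \notin B] >].
have exP : exists j, P j.
  by exists (flen F); apply/asboolP; exists v; split=> //; exact: fterm_top.
case: (ex_minnP exP) => [[|j]] /asboolP Pj minj.
  by case: Pj => w [_ /fterm_bot ->]; rewrite rpred0.
exists j; split=> // [|w wA wj].
  by apply: minj; apply/asboolP; exists v; split=> //; exact: fterm_top.
apply: contraFT (ltnn j) => wB.
by apply: minj; apply/asboolP; exists w.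
Qed.

End Matching.

(** * Comparison of two pseudo-Jordan-Hölder series *)

Section Counting.

(** A relation that is total on P, with values in Q, and injective bounds the
    cardinal of P by that of Q. *)
Lemma leq_card_rel (S T : finType) (P : pred S) (Q : pred T)
    (R : S -> T -> Prop) :
  (forall x, P x -> exists2 y, Q y & R x y) ->
  (forall x x' y, P x -> P x' -> R x y -> R x' y -> x = x') ->
  (#|P| <= #|Q|)%N.
Proof.
move=> exR injR.
have exf (x : {x | x \in P}) : exists y, Q y /\ R (val x) y.
  by have [y Qy Rxy] := exR _ (valP x); exists y.
have [f fP] := choice exf.
have f_inj : injective f.
  move=> x x' fxx'; apply/val_inj.
  apply: (injR _ _ (f x)) (valP x) (valP x') _ _.
    by case: (fP x).
  by rewrite fxx'; case: (fP x').
rewrite -(card_sig P) -(card_codom f_inj).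
apply/subset_leq_card/fintype.subsetP => y.
by case/codomP => x ->; case: (fP x).
Qed.

End Counting.

Section PseudoJordanHolder.
Context {K : fieldType} {g : finLieAlgType K} (rd : rootDatum g).
Context {V : lieModule (extloop g)}.
Implicit Types F : filtration V.

Lemma nontrivial_simple F k : pseudo_JH rd F -> (k < flen F)%N ->
  nontrivial_factor rd (fquot F k) -> simple_module (fquot F k).
Proof.
case=> _ factors _ kF ntk; case: (factors k kF) => [[]//|].
by move=> /(trivial_sum_wte (rd := rd)).
Qed.

(** Each nontrivial factor of [F] is matched with one of [F']. *)
Lemma nontrivial_matched F F' i : pseudo_JH rd F -> pseudo_JH rd F' ->
  (i < flen F)%N -> nontrivial_factor rd (fquot F i) ->
  exists j, [/\ (j < flen F')%N, nontrivial_factor rd (fquot F' j) &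
    matched (fterm F i.+1) (fterm F i) (fterm F' j.+1) (fterm F' j)].
Proof.
move=> JH JH' iF nti; have simi := nontrivial_simple JH iF nti.
have [|j [jF' exv subB]] := first_step (A := fterm F i.+1) (B := fterm F i) F'.
  (* A simple factor is nonzero. *)
  case: (simi) => [[q _ q0] _]; case: (subquot_piP q) q0 => v vA -> v0.
  by exists v => //; apply: contraNN v0 => /(subquot_pi_eq0 _ vA)/eqP.
exists j; case: JH' => _ factors' _.
case: (factors' j jF') => [[simj _ ntj]|trj].
  by split=> //; apply: match_simple => //; exact: fterm_mono.
case: nti; apply: trivial_like_wte.
apply: (trivial_like_subquot (A' := fterm F' j.+1) (B' := fterm F' j)).
- exact: sub_sum.
- by move=> w wA _; exact: subB.
- exact: trivial_sum_trivial_like.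
Qed.

Lemma leq_nontrivial F F' : pseudo_JH rd F -> pseudo_JH rd F' ->
  (#|[pred k : 'I_(flen F) | `[< nontrivial_factor rd (fquot F k) >]]| <=
   #|[pred k : 'I_(flen F') | `[< nontrivial_factor rd (fquot F' k) >]]|)%N.
Proof.
move=> JH JH'.
pose R (i : 'I_(flen F)) (j : 'I_(flen F')) :=
  matched (fterm F i.+1) (fterm F i) (fterm F' j.+1) (fterm F' j).
apply: (leq_card_rel (R := R)) => [i /asboolP nti|i i' j _ _ mi mi'].
  have [j [jF' ntj m]] := nontrivial_matched JH JH' (ltn_ord i) nti.
  by exists (Ordinal jF'); first exact/asboolP.
by apply/val_inj/(matched_inj _ _ (matched_sym mi) (matched_sym mi')).
Qed.

End PseudoJordanHolder.

Theorem proposition4p4 (R : realType) (g : finLieAlgType R[i])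
    (rd : rootDatum g) (V : lieModule (extloop g)) :
  simple_lie g -> Ifin rd V -> indecomposable V ->
  forall F F' : filtration V,
    pseudo_JH rd F -> pseudo_JH rd F' -> equivalent_filtrations rd F F'.
Proof.
move=> _ _ _ F F' JH JH'; split=> [|i iF nti].
  by apply/eqP; rewrite eqn_leq !leq_nontrivial.
have [j [jF' ntj m]] := nontrivial_matched JH JH' iF nti.
exists j => //; apply: matched_isom => //.
  exact: nontrivial_simple JH _ _.
exact: nontrivial_simple JH' _ _.
Qed.
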